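(* Let $\gamma\in\mathbb{R}$ and $1<p<+\infty$. There exists a constant $C>0$ such that, whenever $\omega\in C(\mathbb{R}_+\times\mathbb{R}_+,[0,+\infty))$ is such that every $u\in C^\infty_c(\mathbb{R}_+)$ satisfies, for almost every $x,y\in\mathbb{R}_+$, \[ |u(x)-u(y)|\le\omega(x,y)\Big(\int_{\mathbb{R}_+}|u'(z)|^pz^\gamma\,dz\Big)^{1/p}, \] then for all $x,y\in\mathbb{R}_+$, $\omega(x,y)\ge C\,\Theta_{1-\frac1p,\,1-\frac1p,\,1-\frac{1+\gamma}{p}}(x,y)$.
   Context: $\mathbb{R}_+=(0,+\infty)$ (the case $n=1$ of $\mathbb{R}^n_+$, so $x_n=x$). For $\alpha>0$, $\beta,\kappa\in\mathbb{R}$ and $x,y\in\mathbb{R}_+$: $\Theta_{\alpha,\beta,\kappa}(x,y)=\frac{|x-y|^\beta}{\min(x,y)^{-\kappa}\max(x,y,|x-y|)^\beta}$ if $\kappa<0$; $=\big(\ln(1+(|x-y|/\min(x,y))^{\beta/\alpha})\big)^\alpha$ if $\kappa=0$; $=\frac{|x-y|^\beta}{\max(x,y,|x-y|)^{\beta-\kappa}}$ if $0<\kappa<1+\beta-\alpha$; $=\frac{\max(x,y)^\kappa|x-y|^\beta}{\max(x,y,|x-y|)^\beta}$ if $\kappa\ge 1+\beta-\alpha$. *)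

(* Defs.v *)
From HB Require Import structures.
From mathcomp Require Import all_boot all_order all_algebra.
From mathcomp Require Import all_classical all_reals all_analysis.
Set Implicit Arguments. Unset Strict Implicit. Unset Printing Implicit Defensive.
Import Order.TTheory GRing.Theory Num.Theory.
Import numFieldNormedType.Exports.
Local Open Scope classical_set_scope.
Local Open Scope ring_scope.

Definition Theta {R : realType} (alpha beta kappa : R) (x y : R) : R :=
  let m := Num.min x y in
  let M := Num.max x y in
  let MM := Num.max (Num.max x y) `|x - y| in
  if kappa < 0 then
    `|x - y| `^ beta / (m `^ (- kappa) * MM `^ beta)
  else if kappa == 0 then
    (ln (1 + (`|x - y| / m) `^ (beta / alpha))) `^ alpha
  else if kappa < 1 + beta - alpha then
    `|x - y| `^ beta / MM `^ (beta - kappa)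
  else
    M `^ kappa * `|x - y| `^ beta / MM `^ beta.

(* u is (the extension by zero of) an element of C_c^infty(R_+):
   smooth on R, and vanishing outside a compact interval [a,b] with 0 < a. *)
Definition smooth_compact_pos {R : realType} (u : R -> R) : Prop :=
  (forall (n : nat) (x : R), derivable (iter n (@derive1 R R^o) u) x 1) /\
  exists a b : R, 0 < a /\ a <= b /\
    forall x : R, (x < a \/ b < x) -> u x = 0.

(* Main.v *)
(* For x < y and alpha = 1 - 1/p, Theta equals x^kappa (1 - x/y)^alpha if
   kappa < 0, y^kappa (1 - x/y)^alpha if kappa > 0, and ln(y/x)^alpha if
   kappa = 0. One family of test functions handles all three cases: a fixed
   smooth bump in the variable (ln z - ln a) / L. With a the relevant endpoint
   and 0 < L <= ln(y/x), it is exp(-1) at a and 0 at the other endpoint, and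
   since its derivative is O(1/(L z)) on [a e^-L, a e^L], its energy is at most
   (C L^-1 a^-kappa)^p times the integral 2L of dz/z, as long as
   |kappa| L <= |kappa|, i.e. kappa = 0 or L <= 1. This yields
   omega >= C a^kappa L^alpha; take L = min(1, ln(y/x)) if kappa <> 0, which
   dominates 1 - x/y, and L = ln(y/x) if kappa = 0. The almost-everywhere
   inequality holds everywhere by continuity, since every box has positive
   measure. *)
Require Import Defs.
From HB Require Import structures.
From mathcomp Require Import all_boot all_order all_algebra.
From mathcomp Require Import all_classical all_reals all_analysis.
From mathcomp Require Import measurable_realfun ring lra.
Import Order.TTheory GRing.Theory Num.Theory.
Import numFieldNormedType.Exports.
Local Open Scope classical_set_scope.
Local Open Scope ring_scope.

(** * Smooth functions on open sets and the flat exponential family *)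

Section Smoothness.
Context {R : realType}.
Implicit Types (U V : set R) (f g : R -> R).

(* Existential derivatives make closure under products and compositions, and
   independence of the values of f outside U, immediate; Cn_derivable relates
   Cn to iterated derive1. *)
Fixpoint Cn (n : nat) U f : Prop :=
  if n is m.+1 then
    exists2 f' : R -> R, forall x, U x -> is_derive x 1 f (f' x) & Cn m U f'
  else True.

Lemma CnW n U f : Cn n.+1 U f -> Cn n U f.
Proof. by elim: n f => [//|n IHn] f [f' df /IHn Cf']; exists f'. Qed.

(** Derivatives are local, so a piecewise function [g] can be treated on each open set where it
    agrees with a single formula [f]. *)
Lemma Cn_derivable n U f g : open U -> Cn n.+1 U f -> (forall x, U x -> f x = g x) ->
  forall x, U x -> derivable (iter n (@derive1 R R^o) g) x 1.
Proof.
elim: n f g => [|n IHn] f g oU [f' df Cf'] fg x Ux.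
- have [? _] := df _ Ux; apply: near_eq_derivable; last by eassumption.
  by near=> y; apply: fg; near: y; exact: open_nbhs_nbhs.
- rewrite iterSr; apply: (IHn f') => // y Uy.
  have [_ <-] := df _ Uy; rewrite derive1E; apply: near_eq_derive.
  by near=> z; apply: fg; near: z; exact: open_nbhs_nbhs.
Unshelve. all: by end_near. Qed.

Lemma Cn_cst n U (c : R) : Cn n U (cst c).
Proof. by elim: n c => [//|n IHn] c; exists (cst 0) => // x _; exact: is_derive_cst. Qed.

Lemma CnD n U f g : Cn n U f -> Cn n U g -> Cn n U (fun x => f x + g x).
Proof.
elim: n f g => [//|n IHn] f g [f' df Cf] [g' dg Cg].
exists (fun x => f' x + g' x); last exact: IHn.
by move=> x Ux; apply: is_deriveD; [exact: df|exact: dg].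
Qed.

Lemma CnM n U f g : Cn n U f -> Cn n U g -> Cn n U (fun x => f x * g x).
Proof.
elim: n f g => [//|n IHn] f g Cf Cg.
have [f' df Cf'] := Cf; have [g' dg Cg'] := Cg.
exists (fun x => f x * g' x + g x * f' x).
  by move=> x Ux; apply: is_deriveM; [exact: df|exact: dg].
by apply: CnD; apply: IHn => //; exact: CnW.
Qed.

Lemma Cn_comp n U V f g : (forall x, U x -> V (g x)) ->
  Cn n V f -> Cn n U g -> Cn n U (fun x => f (g x)).
Proof.
move=> gUV; elim: n f => [//|n IHn] f [f' df Cf'] Cg; have [g' dg Cg'] := Cg.
exists (fun x => f' (g x) * g' x); last by apply: CnM => //; apply: IHn => //; exact: CnW.
by move=> x Ux; apply: is_derive1_comp; [exact/df/gUV|exact: dg].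
Qed.

Lemma CnV n U : (forall x, U x -> x != 0) -> Cn n U (fun x => x^-1).
Proof.
move=> U0; elim: n => [//|n IHn]; exists (fun x => (-1) * (x^-1 * x^-1)).
  move=> x Ux; apply: is_derive_eq; first exact: (is_deriveV (U0 _ Ux)).
  by rewrite /GRing.scale /= mulr1 -exprVn expr2 mulN1r.
by do ! [apply: CnM | exact: Cn_cst | exact: IHn].
Qed.

Lemma Cn_ln n U : (forall x, U x -> 0 < x) -> Cn n U (@ln R).
Proof.
move=> U0; case: n => [//|n]; exists (fun x => x^-1); last first.
  by apply: CnV => x /U0/gt_eqF ->.
by move=> x Ux; exact/is_derive1_ln/U0.
Qed.

(* flat 0 is the usual exp(-1/t). The weights t^-k make the family closed under
   differentiation: (flat k)' = -k flat (k+1) + flat (k+2). *)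
Definition flat (k : nat) (t : R) : R :=
  if 0 < t then t ^- k * expR (- t^-1) else 0.

Lemma flat_ge0 k t : 0 <= flat k t.
Proof.
rewrite /flat; case: ifPn => // t0.
by rewrite mulr_ge0 ?expR_ge0// invr_ge0 exprn_ge0// ltW.
Qed.

(** The exponential series gives exp(1/t) >= t^-(k+2) / (k+2)!. The order t^2 yields a zero
    derivative at 0, and the explicit constant later bounds the slope of the bump. *)
Lemma flat_le k t : flat k t <= (k.+2)`!%:R * t ^+ 2.
Proof.
rewrite /flat; case: ifPn => [t0|_]; last by rewrite mulr_ge0 ?sqr_ge0.
have ti0 : 0 <= t^-1 by rewrite invr_ge0 ltW.
have le_exp := expR_ge1Dxn k.+1 ti0.
have f0 : (0 : R) < (k.+2)`!%:R by rewrite ltr0n fact_gt0.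
rewrite expRN ler_pdivrMr ?expR_gt0//.
rewrite -ler_pdivrMl ?mulr_gt0 ?exprn_gt0//.
apply: (le_trans _ le_exp); rewrite exprVn (exprD t 2 k : t ^+ k.+2 = _) !invfM.
by rewrite -[leLHS]mulrA [leLHS]mulrC ler_wpDl.
Qed.

Lemma is_derive_flat k (t : R) :
  is_derive t 1 (flat k) ((- k%:R) * flat k.+1 t + flat k.+2 t).
Proof.
have [t0|t0|->] := ltgtP t 0.
- rewrite /flat (lt_gtF t0) mulr0 add0r.
  suff [d1 d2] : is_derive t 1 (cst 0 : R -> R) 0.
    split; [apply: near_eq_derivable d1|rewrite -{}[RHS]d2; apply: near_eq_derive];
    near=> s; rewrite ?ifF//; apply/lt_gtF; near: s; exact: lt_nbhsl.
  exact: is_derive_cst.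
- rewrite /flat t0.
  suff [d1 d2] : is_derive t 1 (fun s : R => s^-1 ^+ k * expR (- s^-1))
      (- k%:R * (t ^- k.+1 * expR (- t^-1)) + t ^- k.+2 * expR (- t^-1)).
    split; [apply: near_eq_derivable d1|rewrite -{}[RHS]d2; apply: near_eq_derive];
    near=> s; rewrite ?ifT ?exprVn//; near: s; exact: lt_nbhsr.
  have tn0 : t != 0 by rewrite gt_eqF.
  have dV : is_derive t 1 (fun s : R => s^-1) (- t ^- 2).
    by apply: is_derive_eq; [exact: (is_deriveV tn0)|rewrite /GRing.scale /= mulr1].
  have dE : is_derive t 1 (fun s : R => expR (- s^-1)) (expR (- t^-1) * - (- t ^- 2)).
    by apply: (@is_derive1_comp _ expR (fun s => - s^-1)); exact: is_deriveN.
  have dM := is_deriveM (is_deriveX k dV) dE.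
  have fE : (fun s : R => s^-1 ^+ k * expR (- s^-1)) =
      (fun s : R => s^-1) ^+ k * (fun s : R => expR (- s^-1)).
    by rewrite exprfctE.
  rewrite fE; apply: is_derive_eq dM _.
  rewrite /GRing.scale /= -!exprVn exprfctE.
  (* With i = 1/t and E = exp(-1/t) this is a polynomial identity; splitting on [k] removes the
     truncated predecessor [k.-1]. *)
  suff dflatE (E i : R) : i ^+ k * (E * - - i ^+ 2) + E * (k%:R * i ^+ k.-1 * - i ^+ 2) =
      - k%:R * (i ^+ k.+1 * E) + i ^+ k.+2 * E by exact: dflatE.
  by case: (k) => [|j]; rewrite -?pred_Sn ?exprS; ring.
(* At 0 the difference quotient is [flat k h] / h, of absolute value at most (k+2)! |h|. *)
- have -> : - k%:R * flat k.+1 0 + flat k.+2 0 = 0 by rewrite /flat ltxx mulr0 addr0.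
  suff : (fun h : R => h^-1 *: ((flat k \o shift 0) (h *: 1) - flat k 0)) @ 0^' --> (0 : R).
    by move=> l; split; [apply/cvg_ex; exists 0|exact: cvg_lim].
  have fE (h : R) : h^-1 *: ((flat k \o shift 0) (h *: 1) - flat k 0) = h^-1 * flat k h.
    by rewrite /= /GRing.scale /= mulr1 addr0 {2}/flat ltxx subr0.
  under eq_fun do rewrite fE.
  apply/cvgr0Pnorm_le => e e0.
  have f0 : (0 : R) < (k.+2)`!%:R by rewrite ltr0n fact_gt0.
  near=> h.
  have hn0 : h != 0 by near: h; exact: nbhs_dnbhs_neq.
  rewrite normrM normfV (ger0_norm (flat_ge0 _ _)) ler_pdivrMl ?normr_gt0//.
  rewrite (le_trans (flat_le _ _))// -real_normK ?num_real// expr2 mulrA.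
rewrite [leRHS]mulrC ler_pM2r ?normr_gt0// -ler_pdivlMl//.
  by near: h; apply: dnbhs0_le; rewrite mulr_gt0 ?invr_gt0.
Unshelve. all: by end_near. Qed.

Lemma Cn_flat n k U : Cn n U (flat k).
Proof.
elim: n k => [//|n IHn] k.
exists (fun t => (- k%:R) * flat k.+1 t + flat k.+2 t) => [t _|].
  exact: is_derive_flat.
by apply: CnD => //; apply: CnM => //; exact: Cn_cst.
Qed.

End Smoothness.

(** * The bump in the logarithmic variable *)

Section LogBump.
Context {R : realType} (a L : R).
Hypotheses (a0 : 0 < a) (L0 : 0 < L).

(** The standard bump exp(-1/(1 - w^2)) at w = (ln z - ln a)/L. The test on [z] discards the default
    value of [ln] at nonpositive arguments. *)
Definition log_bump (z : R) : R :=
  if 0 < z then flat 0 (1 - ((ln z - ln a) / L) ^+ 2) else 0.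

Lemma log_bump_center : log_bump a = expR (- 1).
Proof. by rewrite /log_bump a0 subrr mul0r expr0n subr0 /flat ltr01 expr0 invr1 mul1r. Qed.

Lemma log_ratio_ge1 z : L <= `|ln z - ln a| -> 1 <= ((ln z - ln a) / L) ^+ 2.
Proof.
move=> Lz; rewrite -real_normK ?num_real//; apply: exprn_ege1.
by rewrite normrM normfV (gtr0_norm L0) ler_pdivlMr// mul1r.
Qed.

Lemma log_bump_out z : 0 < z -> L <= `|ln z - ln a| -> log_bump z = 0.
Proof.
move=> z0 Lz; rewrite /log_bump z0 /flat ifF//; apply/negbTE; rewrite -leNgt subr_le0.
by apply: log_ratio_ge1.
Qed.

(** Two open sets cover the line: on z > 0 the bump is a composition of smooth functions, and z <= 0
    lies in the half-line below a exp(-L), where it vanishes identically. *)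
Lemma log_bump_smooth : smooth_compact_pos log_bump.
Proof.
have lnaL (z : R) : 0 < z -> (z < a * expR (- L) \/ a * expR L < z) -> L <= `|ln z - ln a|.
  move=> z0 [] h; rewrite ler_normr; apply/orP; [right|left];
    move: h; rewrite -ltr_ln ?posrE ?mulr_gt0 ?expR_gt0// lnM ?posrE ?expR_gt0// expRK => ?; lra.
have zero (z : R) : (z < a * expR (- L) \/ a * expR L < z) -> log_bump z = 0.
  move=> h; have [z0|z0] := ltP 0 z; first exact/log_bump_out/lnaL.
  by rewrite /log_bump ltNge z0.
split; last first.
  exists (a * expR (- L)), (a * expR L); split; first by rewrite mulr_gt0 ?expR_gt0.
  by split=> //; rewrite ler_pM2l// ler_expR (le_trans _ (ltW L0))// oppr_le0 ltW.
move=> n z; have [z0|z0] := ltP 0 z.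
- apply: (@Cn_derivable _ n [set x | 0 < x]
    (fun z => flat 0 (1 + (-1) * (((ln z + - ln a) * L^-1) * ((ln z + - ln a) * L^-1))))) => //.
  + have Cw : Cn n.+1 [set x | 0 < x] (fun z : R => (ln z + - ln a) * L^-1).
      by apply: CnM; [apply: CnD; [exact: Cn_ln|exact: Cn_cst]|exact: Cn_cst].
    apply: (@Cn_comp _ _ _ setT) => //; first exact: Cn_flat.
    by apply: CnD; [exact: Cn_cst|apply: CnM; [exact: Cn_cst|exact: CnM]].
  + by move=> x x0; rewrite /log_bump x0 mulN1r expr2.
- apply: (@Cn_derivable _ n [set x | x < a * expR (- L)] (cst 0)) => //.
  + exact: Cn_cst.
  + by move=> x xa; rewrite zero//; left.
  + by rewrite /= (le_lt_trans z0)// mulr_gt0 ?expR_gt0.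
Qed.

(** In the derivative of [flat 0] the [flat 1] term has coefficient 0, so only [flat 2] survives the
    chain rule. *)
Lemma derive_log_bump (z : R) : 0 < z ->
  (@derive1 R R^o) log_bump z =
  flat 2 (1 - ((ln z - ln a) / L) ^+ 2) * (- 2 * ((ln z - ln a) / L) * (L^-1 * z^-1)).
Proof.
move=> z0; set w := fun z : R => (ln z - ln a) * L^-1.
have dw : is_derive z 1 w (L^-1 * z^-1).
  have dl := is_derive1_ln z0.
  have dsub : is_derive z 1 (fun x : R => ln x - ln a) z^-1.
    by rewrite -[z^-1]subr0; apply: is_deriveB => //; exact: is_derive_cst.
  have := is_deriveM dsub (is_derive_cst L^-1 z 1).
  by move=> /is_derive_eq; apply; rewrite /GRing.scale /= mulr0 add0r.
have dw2 : is_derive z 1 (fun x => 1 - w x * w x) (- 2 * w z * (L^-1 * z^-1)).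
  have := is_deriveB (is_derive_cst (1 : R) z 1) (is_deriveM dw dw).
  by move=> /is_derive_eq; apply; rewrite /GRing.scale /=; ring.
have dF := @is_derive1_comp _ (flat 0) _ _ _ _ (is_derive_flat 0 _) dw2.
have [_] := dF; rewrite mulr0n oppr0 mul0r add0r expr2 => <-; rewrite derive1E.
by apply: near_eq_derive; near=> x; rewrite /log_bump ifT ?expr2//; near: x; exact: lt_nbhsr.
Unshelve. all: by end_near. Qed.

Lemma derive_log_bump_out (z : R) : 0 < z -> L <= `|ln z - ln a| ->
  (@derive1 R R^o) log_bump z = 0.
Proof.
move=> z0 Lz; rewrite derive_log_bump// /flat ifF ?mul0r//; apply/negbTE; rewrite -leNgt subr_le0.
by apply: log_ratio_ge1.
Qed.

Lemma derive_log_bump_le (z : R) : 0 < z ->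
  `|(@derive1 R R^o) log_bump z| <= 48%:R / L / z.
Proof.
move=> z0; have [Lz|zL] := leP L `|ln z - ln a|.
  by rewrite derive_log_bump_out// normr0 !mulr_ge0// invr_ge0 ltW.
rewrite derive_log_bump// 2!normrM (ger0_norm (flat_ge0 _ _)).
set w := (ln z - ln a) / L.
have w1 : `|w| <= 1 by rewrite normrM normfV (gtr0_norm L0) ler_pdivrMr// mul1r ltW.
have w2 : w ^+ 2 <= 1 by rewrite -real_normK ?num_real// expr_le1.
rewrite [`|L^-1 * _|]gtr0_norm ?mulr_gt0 ?invr_gt0// -mulrA mulrA ler_pM2r ?mulr_gt0 ?invr_gt0//.
(* 24 is 4!, from [flat_le] at k = 2 with argument in [0, 1]; the factor 2 |w| <= 2 then gives
   48. *)
have f24 : flat 2 (1 - w ^+ 2) <= 24%:R.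
  rewrite (le_trans (flat_le _ _))// -[leRHS]mulr1 ler_wpM2l// expr_le1//
    ?lerBlDr ?lerDl ?sqr_ge0//.
  by rewrite subr_ge0.
have -> : 48%:R = 24%:R * 2%:R :> R by rewrite -natrM.
apply: ler_pM => //; first exact: flat_ge0.
by rewrite normrM normrN normr_nat ler_piMr.
Qed.

End LogBump.

(** * Weighted energy of the bump *)

Section Energy.
Context {R : realType} (a L p gamma kappa : R).
Hypotheses (a0 : 0 < a) (L0 : 0 < L) (p1 : 1 < p).
Hypotheses (kappaE : kappa = 1 - (1 + gamma) / p) (kappaL : `|kappa| * L <= `|kappa|).

Lemma powR_expE (x r : R) : 0 < x -> x `^ r = expR (r * ln x).
Proof. by move=> x0; rewrite /powR gt_eqF. Qed.

(** Bound for |u'(t)| t^(1 - kappa), with u the bump: 48/L controls |u'(t)| t, and the other factor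
    controls t^-kappa on the support. *)
Let K := 48%:R / L * (a `^ (- kappa) * expR `|kappa|).

Let K_ge0 : 0 <= K.
Proof. by rewrite !mulr_ge0 ?powR_ge0 ?expR_ge0// invr_ge0 ltW. Qed.

Lemma log_bump_energy_density (t : R) : 0 < t ->
  `|(@derive1 R R^o) (log_bump a L) t| `^ p * t `^ gamma <=
  if `|ln t - ln a| <= L then K `^ p / t else 0.
Proof.
move=> t0; have p0 : 0 < p := lt_trans ltr01 p1.
case: ifPn => [tL|]; last first.
  rewrite -ltNge => /ltW tL.
  by rewrite derive_log_bump_out// normr0 powR0 ?mul0r// gt_eqF.
have LV0 : 0 <= 48%:R / L by rewrite mulr_ge0// invr_ge0 ltW.
(* On the support, |kappa (ln t - ln a)| <= |kappa| L <= |kappa|. *)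
have tK : t `^ (- kappa) <= a `^ (- kappa) * expR `|kappa|.
  rewrite !powR_expE// -expRD ler_expR -lerBlDl -mulrBr mulNr.
  rewrite (le_trans (ler_norm _))// normrN normrM (le_trans _ kappaL)//.
  by rewrite ler_wpM2l.
(* Here gamma = p (1 - kappa) - 1, so the density becomes a p-th power against the scale-invariant
   measure dt/t. *)
have -> : t `^ gamma = (t * t `^ (- kappa)) `^ p / t.
  rewrite (powR_expE t gamma)// (powR_expE t (- kappa))//.
  have -> : t * expR (- kappa * ln t) = expR (ln t - kappa * ln t).
    by rewrite expRD lnK ?posrE// mulNr.
  rewrite powR_expE ?expR_gt0// expRK -[X in _ = _ / X]lnK ?posrE// -expRN -expRD; congr expR.
  by rewrite kappaE; field; rewrite gt_eqF.
rewrite mulrA ler_pM2r ?invr_gt0// -powRM ?mulr_ge0 ?powR_ge0 ?(ltW t0)//.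
apply: (ge0_ler_powR (ltW p0)); rewrite ?nnegrE//.
  by rewrite !mulr_ge0 ?powR_ge0 ?(ltW t0).
apply: (@le_trans _ _ (48%:R / L / t * (t * t `^ (- kappa)))).
  by apply: ler_wpM2r; [rewrite mulr_ge0 ?powR_ge0 ?(ltW t0)|exact: derive_log_bump_le].
by rewrite mulrA divfK ?gt_eqF// ler_wpM2l.
Qed.

Lemma measurable_derive_log_bump :
  measurable_fun setT ((@derive1 R R^o) (log_bump a L)).
Proof.
apply: continuous_measurable_fun => z.
have [/(_ 1 z) + _] := log_bump_smooth _ _ a0 L0.
by move=> /= /derivable1_diffP/differentiable_continuous.
Qed.

Lemma within_continuous_divl (c b d : R) : 0 < b ->
  {within `[b, d], continuous (fun t => c / t)}.
Proof.
move=> b0; apply: derivable_within_continuous => t; rewrite in_itv /= => /andP[bt _].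
have dV := is_deriveV (lt0r_neq0 (lt_le_trans b0 bt)) (is_derive_id t 1).
by have [d' _] := is_deriveM (is_derive_cst c t 1) dV; exact: d'.
Qed.

(** For dt/t the interval has length 2 L: its endpoints have logarithms ln a - L and ln a + L. *)
Lemma integral_invr_log_ball :
  (\int[@lebesgue_measure R]_(t in `[(a * expR (- L))%R, (a * expR L)%R]) (K `^ p / t)%:E =
   (K `^ p * (2 * L))%:E)%E.
Proof.
have lo0 : 0 < a * expR (- L) by rewrite mulr_gt0 ?expR_gt0.
have pos t : t \in `[a * expR (- L), a * expR L] -> 0 < t.
  by rewrite in_itv /= => /andP[+ _]; exact: lt_le_trans.
have dF (t : R) : 0 < t -> is_derive t 1 (fun x => K `^ p * ln x) (K `^ p / t).
  move=> t0; have := is_deriveM (is_derive_cst (K `^ p) t 1) (is_derive1_ln t0).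
  by move=> /is_derive_eq; apply; rewrite /GRing.scale /= mulr0 addr0.
have cF (t : R) : 0 < t -> {for t, continuous (fun x => K `^ p * ln x)}.
  by move=> /dF[d _]; exact/differentiable_continuous/derivable1_diffP.
have lohi : a * expR (- L) < a * expR L by rewrite ltr_pM2l// ltr_expR gtrN.
rewrite (@continuous_FTC2 _ _ (fun x => K `^ p * ln x))//.
- rewrite !lnM ?posrE ?expR_gt0// !expRK -EFinB; congr EFin; ring.
- exact: within_continuous_divl.
- split.
  + by move=> t /subset_itv_oo_cc/pos/dF[].
  + exact/cvg_at_right_filter/cF.
  + apply/cvg_at_left_filter/cF; exact: lt_trans lohi.
- by move=> t /subset_itv_oo_cc/pos/dF[_ <-]; rewrite derive1E.
Qed.

Lemma log_bump_energy :
  (\int[@lebesgue_measure R]_(t in (`]0%R, +oo[%classic : set R))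
     ((`|(@derive1 R R^o) (log_bump a L) t| `^ p) * t `^ gamma)%:E
   <= (K `^ p * (2 * L))%:E)%E.
Proof.
rewrite -integral_invr_log_ball.
set I := `[a * expR (- L), a * expR L]%classic : set R.
set J := (`]0%R, +oo[%classic : set R).
have JI : J `&` I = I.
  apply/seteqP; split=> t /=; first by case.
  move=> It; split=> //; move: It; rewrite /I /J /= !in_itv /= andbT => /andP[+ _].
  by apply: lt_le_trans; rewrite mulr_gt0 ?expR_gt0.
(* Extending the integrand on [I] by zero makes both sides integrals over [J], so a pointwise
   comparison suffices. *)
rewrite -[X in (_ <= \int[_]_(_ in X) _)%E]JI integral_mkcondr.
have mD : measurable_fun J (fun t => ((`|(@derive1 R R^o) (log_bump a L) t| `^ p) * t `^ gamma)%:E).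
  apply/measurable_EFinP/measurable_funTS/measurable_funM; last exact: measurable_powR.
  apply: (measurableT_comp (measurable_powR p)).
  by apply: measurableT_comp => //; exact: measurable_derive_log_bump.
have mI : measurable_fun J ((fun t : R => (K `^ p / t)%:E) \_ I).
  have [+ _] := @measurable_restrict _ _ R _ I J
    (fun t : R => (K `^ p / t)%:E) (measurable_itv _) (measurable_itv _).
  rewrite JI; apply; apply/measurable_EFinP. apply: (@subspace_continuous_measurable_fun _ I).
    exact: measurable_itv.
  by apply: within_continuous_divl; rewrite mulr_gt0 ?expR_gt0.
apply: ge0_le_integral => //.
- exact: measurable_itv.
- by move=> t _; rewrite lee_fin mulr_ge0 ?powR_ge0.
- move=> t; rewrite /J /= in_itv /= andbT => t0.
  apply: (@le_trans _ _ (if `|ln t - ln a| <= L then K `^ p / t else 0)%:E).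
    by rewrite lee_fin; exact: log_bump_energy_density.
  rewrite /patch; case: ifPn => [tL|_]; last first.
    by case: ifPn => // _; rewrite lee_fin mulr_ge0 ?powR_ge0// invr_ge0 ltW.
  rewrite ifT// inE /I /= in_itv /=; apply/andP.
  move: tL; rewrite ler_norml => /andP[tl tr].
  by split; rewrite -ler_ln ?posrE ?mulr_gt0 ?expR_gt0// lnM ?posrE ?expR_gt0// expRK; lra.
Qed.

End Energy.

(** * Lower bound for [omega] from a single bump *)

Section LowerBound.
Context {R : realType}.

Lemma ae_continuous_ge0 (A : set (R * R)) (f : R * R -> R) :
  open A -> {in A, continuous f} ->
  {ae ((@lebesgue_measure R) \x (@lebesgue_measure R))%E, forall z, A z -> 0 <= f z} ->
  forall z, A z -> 0 <= f z.
Proof.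
move=> oA cf [N [mN N0 fN]] z Az; rewrite leNgt; apply/negP => fz0.
have : nbhs z [set w | A w /\ f w < 0].
  apply: filterI; first exact: open_nbhs_nbhs.
  by apply: (cf z _ [set r | r < 0]); [rewrite inE|exact: lt_nbhsl].
move=> /nbhs_ballP[e /= e0 eN].
(* A ball of the product is a product of balls, so its measure is the product of two positive
   lengths, yet it sits inside a null set. *)
have sub : ball z.1 e `*` ball z.2 e `<=` N.
  move=> w [w1 w2]; apply: fN => /=; have [Aw fw] : A w /\ f w < 0 by apply: eN; split.
  by move=> /(_ Aw); rewrite leNgt fw.
have mb (r : R) : measurable (ball r e) by exact: measurable_ball.
suff : (((@lebesgue_measure R) \x (@lebesgue_measure R)) (ball z.1 e `*` ball z.2 e) > 0)%E.
  rewrite ltNge -N0 => /negP; apply; apply: le_measure => //; rewrite inE//.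
  by apply: measurableX; exact: mb.
rewrite product_measure1E; [|exact: mb|exact: mb].
by rewrite mule_gt0 // [X in (0 < X)%E]lebesgue_measure_ball ?(ltW e0)// lte_fin mulr2n addr_gt0.
Qed.

(** The bump centred at [a] differs by exp(-1) between [a] and [b], which is compared with its
    energy. Both orders of the pair are covered, as [omega] is not assumed symmetric. *)
Lemma log_bump_lower_bound (gamma p kappa : R) (omega : R -> R -> R) :
  1 < p -> kappa = 1 - (1 + gamma) / p ->
  {within [set z : R * R | 0 < z.1 /\ 0 < z.2],
     continuous (fun z : R * R => omega z.1 z.2)} ->
  (forall x y : R, 0 < x -> 0 < y -> 0 <= omega x y) ->
  (forall u : R -> R, smooth_compact_pos u ->
     {ae ((@lebesgue_measure R) \x (@lebesgue_measure R))%E,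
       forall z : R * R, 0 < z.1 -> 0 < z.2 ->
         ((`|u z.1 - u z.2|)%:E <=
          (omega z.1 z.2)%:E *
          (\int[@lebesgue_measure R]_(t in (`]0%R, +oo[%classic : set R))
              ((`|(@derive1 R R^o u) t| `^ p) * t `^ gamma)%:E) `^ p^-1)%E}) ->
  forall a b L : R, 0 < a -> 0 < b -> 0 < L -> L <= `|ln b - ln a| ->
    `|kappa| * L <= `|kappa| ->
  forall x y : R, x = a /\ y = b \/ x = b /\ y = a ->
    expR (- 1) / (48%:R * expR `|kappa| * 2 `^ p^-1) *
      (a `^ kappa * L `^ (1 - p^-1)) <= omega x y.
Proof.
move=> p1 kE cw w0 hu a b L a0 b0 L0 Lb kL x y xyab.
have p0 : 0 < p := lt_trans ltr01 p1.
pose K := 48%:R / L * (a `^ (- kappa) * expR `|kappa|).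
have K0 : 0 < K by rewrite /K !mulr_gt0 ?powR_gt0 ?expR_gt0 ?invr_gt0.
pose B := K * (2 * L) `^ p^-1.
have B0 : 0 < B by apply: mulr_gt0 => //; apply/powR_gt0/mulr_gt0.
have oQ : open [set z : R * R | 0 < z.1 /\ 0 < z.2].
  apply: (@openI _ (fst @^-1` [set r : R | 0 < r]) (snd @^-1` [set r : R | 0 < r])).
    by apply: open_comp => [z _|]; [exact: cvg_fst|exact: open_gt].
  by apply: open_comp => [z _|]; [exact: cvg_snd|exact: open_gt].
have sm := log_bump_smooth _ _ a0 L0.
have cu (z : R) : {for z, continuous (log_bump a L)}.
  have [/(_ 0%N z) + _] := sm.
  by move=> /= /derivable1_diffP/differentiable_continuous.
have wB z : [set z : R * R | 0 < z.1 /\ 0 < z.2] z ->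
    0 <= omega z.1 z.2 * B - `|log_bump a L z.1 - log_bump a L z.2|.
  move: z; apply: (@ae_continuous_ge0 _
    (fun z => omega z.1 z.2 * B - `|log_bump a L z.1 - log_bump a L z.2|)) => //.
    move: cw; rewrite continuous_open_subspace// => cw z' zQ.
    apply: cvgB.
      by apply: cvgM; [exact: cw|exact: cvg_cst].
    apply: cvg_norm; apply: cvgB.
      by apply: (@continuous_comp _ _ _ fst (log_bump a L)); [exact: cvg_fst|exact: cu].
    by apply: (@continuous_comp _ _ _ snd (log_bump a L)); [exact: cvg_snd|exact: cu].
  apply: negligibleS (hu _ sm) => z' /=; apply: contra_not => + [z1 z2] => /(_ z1 z2) huz.
  rewrite subr_ge0 -lee_fin EFinM (le_trans huz)// lee_wpmul2l ?lee_fin ?w0//.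
  have -> : B%:E = ((K `^ p * (2 * L))%:E `^ p^-1)%E.
    rewrite poweR_EFin powRM ?powR_ge0 ?mulr_ge0 ?(ltW L0)//.
    by rewrite -powRrM mulfV ?gt_eqF// powRr1// ltW.
  apply: gt0_ler_poweR.
  - by rewrite invr_ge0 ltW.
  - rewrite in_itv /= leey andbT integral_ge0//.
    by move=> t _; rewrite lee_fin mulr_ge0 ?powR_ge0.
  - by rewrite in_itv /= leey andbT lee_fin mulr_ge0 ?powR_ge0 ?mulr_ge0 ?(ltW L0).
  - exact: log_bump_energy.
(* log_bump equals exp(-1) at a and 0 at b, so wB at (x, y) reads exp(-1) <= omega x y * B. *)
have -> : expR (- 1) / (48%:R * expR `|kappa| * 2 `^ p^-1) * (a `^ kappa * L `^ (1 - p^-1))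
    = expR (- 1) / B.
  rewrite powRB; last by rewrite (gt_eqF L0) implybT.
  rewrite powRr1 ?(ltW L0)// /B /K powRM ?(ltW L0)// powRN.
  have ? : a `^ kappa != 0 by rewrite gt_eqF// powR_gt0.
  have ? : L `^ p^-1 != 0 by rewrite gt_eqF// powR_gt0.
  have ? : 2 `^ p^-1 != 0 :> R by rewrite gt_eqF// powR_gt0.
  have ? : expR `|kappa| != 0 by rewrite gt_eqF// expR_gt0.
  by field; rewrite (gt_eqF L0) /=; do ! (apply/andP; split).
rewrite ler_pdivrMr//.
have xy0 : 0 < x /\ 0 < y by case: xyab => -[-> ->].
have := wB (x, y) xy0; rewrite subr_ge0 /=; apply: le_trans.
by case: xyab => -[-> ->]; rewrite log_bump_center// (@log_bump_out _ a L)//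
  ?subr0 ?sub0r ?normrN ger0_norm ?expR_ge0.
Qed.

(** * Symmetry, diagonal values and reduced form of [Theta] *)

Lemma ThetaC (alpha beta kappa x y : R) :
  Theta alpha beta kappa x y = Theta alpha beta kappa y x.
Proof. by rewrite /Theta (minC x) (maxC x) (distrC x). Qed.

Lemma Theta_diag (alpha kappa x : R) : alpha != 0 -> Theta alpha alpha kappa x x = 0.
Proof.
move=> al0; rewrite /Theta subrr normr0 divff// mul0r !powR0 ?oner_eq0// addr0 ln1 powR0//.
by rewrite mulr0 !mul0r !if_same.
Qed.

(** For x < y the largest of x, y, |x - y| is y, and 1 + |x - y|/x = y/x. With beta = alpha the
    ranges 0 < kappa < 1 and kappa >= 1 give the same expression. *)
Lemma Theta_lt (alpha kappa x y : R) : alpha != 0 -> 0 < x -> x < y ->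
  Theta alpha alpha kappa x y =
  if kappa == 0 then ln (y / x) `^ alpha
  else (if kappa < 0 then x else y) `^ kappa * (1 - x / y) `^ alpha.
Proof.
move=> al0 x0 xy; have y0 := lt_trans x0 xy.
rewrite /Theta (min_l (ltW xy)) (max_r (ltW xy)).
have -> : `|x - y| = y * (1 - x / y).
  by rewrite distrC gtr0_norm ?subr_gt0// mulrBr mulr1 mulrCA divff ?gt_eqF// mulr1.
have l0 : 0 <= 1 - x / y by rewrite subr_ge0 ler_pdivrMr// mul1r ltW.
rewrite max_l; last first.
  by rewrite ler_piMr ?(ltW y0)// gerBl divr_ge0 ?ltW.
rewrite (powRM alpha (ltW y0) l0).
have ya : y `^ alpha != 0 by rewrite gt_eqF// powR_gt0.
have xk : x `^ kappa != 0 by rewrite gt_eqF// powR_gt0.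
have yk : y `^ kappa != 0 by rewrite gt_eqF// powR_gt0.
case: ifPn => [k0|k0].
  by rewrite lt_eqF// powRN; field; rewrite ?ya ?xk.
case: ifPn => [_|k1].
  rewrite divff// powRr1 ?divr_ge0 ?mulr_ge0 ?(ltW x0) ?(ltW y0)//; congr (ln _ `^ _).
  by field; rewrite !gt_eqF.
rewrite powRB ?(gt_eqF y0) ?implybT//.
by case: ifPn => _; field; rewrite ?ya ?yk.
Qed.

End LowerBound.

(** * Choice of centre and width of the bump for each sign of [kappa] *)

Theorem theorem1p3 (R : realType) (gamma p : R) (hp : 1 < p) :
  exists C : R, 0 < C /\
  forall omega : R -> R -> R,
    {within [set z : R * R | 0 < z.1 /\ 0 < z.2],
       continuous (fun z : R * R => omega z.1 z.2)} ->
    (forall x y : R, 0 < x -> 0 < y -> 0 <= omega x y) ->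
    (forall u : R -> R, smooth_compact_pos u ->
       {ae ((@lebesgue_measure R) \x (@lebesgue_measure R))%E,
         forall z : R * R, 0 < z.1 -> 0 < z.2 ->
           ((`|u z.1 - u z.2|)%:E <=
            (omega z.1 z.2)%:E *
            (\int[@lebesgue_measure R]_(t in (`]0%R, +oo[%classic : set R))
                ((`|(@derive1 R R^o u) t| `^ p) * t `^ gamma)%:E) `^ p^-1)%E}) ->
    forall x y : R, 0 < x -> 0 < y ->
      C * Theta (1 - p^-1) (1 - p^-1) (1 - (1 + gamma) / p) x y <= omega x y.
Proof.
have p0 : 0 < p := lt_trans ltr01 hp.
set kappa := 1 - (1 + gamma) / p; set alpha := 1 - p^-1.
have al0 : 0 < alpha by rewrite subr_gt0 invf_lt1.
set C := expR (- 1) / (48%:R * expR `|kappa| * 2 `^ p^-1).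
have C0 : 0 < C by rewrite divr_gt0 ?mulr_gt0 ?expR_gt0 ?powR_gt0.
exists C; split=> // omega cw w0 hu.
have bound := @log_bump_lower_bound R gamma p kappa omega hp erefl cw w0 hu.
have main x y : 0 < x -> x < y ->
    C * Theta alpha alpha kappa x y <= omega x y /\
    C * Theta alpha alpha kappa x y <= omega y x.
  move=> x0 xy; have y0 := lt_trans x0 xy.
  have lnxy : 0 < ln (y / x) by rewrite ln_gt0// ltr_pdivlMr// mul1r.
  have lnE : ln (y / x) = ln y - ln x by rewrite ln_div.
  (* This is 1 - h <= exp(-h) at h = ln(y/x). *)
  have lamln : 1 - x / y <= ln (y / x).
    have := expR_ge1Dx (- ln (y / x)).
    by rewrite expRN lnK ?posrE ?divr_gt0// invf_div; lra.
  have lam1 : 1 - x / y <= 1 by rewrite gerBl divr_ge0 ?ltW.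
  have lam0 : 0 <= 1 - x / y by rewrite subr_ge0 ler_pdivrMr// mul1r ltW.
  have nxy : `|ln x - ln y| = ln (y / x) by rewrite distrC -lnE gtr0_norm.
  have nyx : `|ln y - ln x| = ln (y / x) by rewrite -lnE gtr0_norm.
  (* When kappa = 0 the width constraint reads 0 <= 0, so the full width L = ln(y/x) is allowed. *)
  rewrite (Theta_lt _ _ _ _ (lt0r_neq0 al0) x0 xy); case: ifPn => [/eqP k0|k0].
    have := bound x y _ x0 y0 lnxy; rewrite -/C -/alpha k0 powRr0 mul1r nyx normr0 mul0r => b.
    by split; apply: b => //; [left|right].
  (* For kappa <> 0 the weight must stay comparable on the support, hence L <= 1. *)
  pose L := Num.min 1 (ln (y / x)).
  have L0 : 0 < L by rewrite lt_min ltr01.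
  have lamL : (1 - x / y) `^ alpha <= L `^ alpha.
    apply: (ge0_ler_powR (ltW al0)); rewrite ?nnegrE ?(ltW L0)//.
    by rewrite le_min lam1.
  have kL : `|kappa| * L <= `|kappa| by rewrite ler_piMr// ge_min lexx.
  have Lln : L <= ln (y / x) by rewrite ge_min lexx orbT.
  have Lyx : L <= `|ln y - ln x| by rewrite nyx.
  have Lxy : L <= `|ln x - ln y| by rewrite nxy.
  (* The centre is the point whose power occurs in [Theta]: [x] for kappa < 0, [y] for kappa > 0. *)
  case: ifPn => _.
    have b x' y' (xy' : x' = x /\ y' = y \/ x' = y /\ y' = x) :
        C * (x `^ kappa * (1 - x / y) `^ alpha) <= omega x' y'.
      have := bound x y L x0 y0 L0 Lyx kL x' y' xy'; apply: le_trans.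
      by rewrite (ler_pM2l C0) ler_wpM2l ?powR_ge0.
    by split; apply: b; [left|right].
  have b x' y' (xy' : x' = y /\ y' = x \/ x' = x /\ y' = y) :
      C * (y `^ kappa * (1 - x / y) `^ alpha) <= omega x' y'.
    have := bound y x L y0 x0 L0 Lxy kL x' y' xy'; apply: le_trans.
    by rewrite (ler_pM2l C0) ler_wpM2l ?powR_ge0.
  by split; apply: b; [right|left].
move=> x y x0 y0; have [xy|yx|<-] := ltgtP x y.
- by have [] := main x y x0 xy.
- by rewrite ThetaC; have [] := main y x y0 yx.
- by rewrite Theta_diag ?gt_eqF// mulr0 w0.
Qed.
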